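(* Assume the standing assumptions in the context, and let $f\in AC([T,x_0))$. The following are equivalent: (i) there are real numbers $a_1,a_2$ with $f(x)=a_1\phi_1(x)+a_2\phi_2(x)+o(\phi_2(x))$ as $x\to x_0$; (ii) the finite limit $$\lim_{x\to x_0}\frac{\phi_1(x)}{\phi_2(x)}\int_x^{x_0}W(t)\phi_1(t)^{-2}f_2^*(t)\,dt\equiv\lim_{x\to x_0}\frac{\phi_1(x)}{\phi_2(x)}\int_x^{x_0}\Big(\frac{\phi_2(t)}{\phi_1(t)}\Big)'f_2^*(t)\,dt=:-m$$ exists (the improper integrals being convergent); (iii) the finite limit $$\lim_{x\to x_0}\frac{\Phi(x)}{\phi_2(x)}\int_x^{x_0}W(t)\Phi(t)^{-2}F^*(t)\,dt=:-\frac{l}{\phi_2(T)}$$ exists (the improper integral being convergent). If this is the case then, with $a_1,a_2$ as in (i) and $m,l$ as in (ii),(iii), $$f(x)=a_1\phi_1(x)+a_2\phi_2(x)-\phi_1(x)\int_x^{x_0}\Big(\frac{\phi_2(t)}{\phi_1(t)}\Big)'[f_2^*(t)-m]\,dt,\qquad x\in[T,x_0),$$ $$f(x)=a_1\phi_1(x)+a_2\phi_2(x)-\Phi(x)\int_x^{x_0}W(t)\Phi(t)^{-2}[F^*(t)-l]\,dt,\qquad x\in(T,x_0).$$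
   Context: Let $x_0\in\mathbb{R}\cup\{+\infty\}$, $T\in\mathbb{R}$ with $T<x_0$, and $I:=[T,x_0)$. All limits and asymptotic relations ''as $x\to x_0$'' are taken for $x\in I$. For differentiable $g,h$ put $W(g,h;x):=g(x)h'(x)-g'(x)h(x)$. Standing assumptions: $\phi_1,\phi_2\in C^1(I)$; $\phi_2(x)=o(\phi_1(x))$ as $x\to x_0$; $\phi_1(x)\ne0$, $\phi_2(x)\neq0$ for all $x\in I$; $W(x):=W(\phi_1,\phi_2;x)\ne0$ for all $x\in I$. $AC([T,x_0))$ denotes functions absolutely continuous on every compact subinterval of $I$. For such $f$ and every $t\in I$ where $f$ is differentiable define $f_1^*(t):=W(f,\phi_2;t)/W(t)$, $f_2^*(t):=-W(f,\phi_1;t)/W(t)$; put $\Phi(x):=\phi_2(T)\phi_1(x)-\phi_1(T)\phi_2(x)$ and $F^*(t):=\phi_1(T)f_1^*(t)+\phi_2(T)f_2^*(t)=W(\Phi,f;t)/W(t)$. *)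

(* Defs.v *)
From HB Require Import structures.
From mathcomp Require Import all_boot all_order all_algebra.
From mathcomp Require Import all_classical all_reals all_analysis.
Set Implicit Arguments. Unset Strict Implicit. Unset Printing Implicit Defensive.
Import Order.TTheory GRing.Theory Num.Theory.
Import numFieldNormedType.Exports.
Local Open Scope classical_set_scope.
Local Open Scope ring_scope.

Section Defs.
Variable R : realType.
Implicit Types (f g h dg dh : R -> R).

Definition Iset (T : R) (x0 : \bar R) : set R := [set x | T <= x /\ (x%:E < x0)%E].

(* The filter "x -> x0 with x in I": left limit at a finite x0, +oo otherwise.
   (The -oo branch is never used since T < x0.) *)
Definition to_x0 (x0 : \bar R) : set_system R :=
  match x0 with
  | EFin r => at_left r
  | +oo%E => pinfty_nbhs R
  | -oo%E => ninfty_nbhs R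
  end.

Definition littleo_at (F : set_system R) h g :=
  forall e : R, 0 < e -> \forall x \near F, `|h x| <= e * `|g x|.

Definition deriv_within (A : set R) g dg :=
  forall x, A x -> (fun y => (g y - g x) / (y - x)) @ within (A `\ x) (nbhs x) --> dg x.

Definition C1_on (A : set R) g dg := deriv_within A g dg /\ {within A, continuous dg}.

Definition abs_cont_on (a b : R) f :=
  forall e : R, 0 < e -> exists d : R, 0 < d /\
    forall (n : nat) (u v : nat -> R),
      (forall k, (k < n)%N -> a <= u k /\ u k <= v k /\ v k <= b) ->
      (forall j k, (j < n)%N -> (k < n)%N -> j <> k -> v j <= u k \/ v k <= u j) ->
      \sum_(k < n) (v k - u k) < d ->
      \sum_(k < n) `|f (v k) - f (u k)| < e.

Definition AC_on (T : R) (x0 : \bar R) f :=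
  forall a b, Iset T x0 a -> Iset T x0 b -> a <= b -> abs_cont_on a b f.

Definition wronsk g dg h dh (t : R) := g t * dh t - dg t * h t.

Definition improper_int (x0 : \bar R) g (x L : R) :=
  (forall y, x <= y -> (y%:E < x0)%E ->
     (@lebesgue_measure R).-integrable `[x, y] (EFin \o g)) /\
  (fun y => \int[@lebesgue_measure R]_(t in `[x, y]) g t) @ to_x0 x0 --> L.

End Defs.

(* Main.v *)
(** The integrands are derivatives of quotients: W / phi1^2 * f2s = (f / phi1)' and
    W / Phi^2 * Fs = (f / Phi)' almost everywhere, while W / phi1^2 = (phi2 / phi1)'
    and W / Phi^2 = (phi2 / Phi)' / phi2(T).  As f / psi is absolutely continuous for
    psi = phi1 and psi = Phi, its improper integral from x converges iff f / psi has
    a limit c, and then equals c - f(x) / psi(x).  Hence (ii) and (iii) both say that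
    (f - c * psi) / phi2 converges for some c, which for psi = phi1 is (i) and for
    psi = Phi, a combination of phi1 and phi2, is equivalent to it.  The
    representation formulas are the same computation for f - m * phi2.

    The fundamental theorem of calculus for an absolutely continuous f goes through
    the Jordan decomposition: the total variation V of f is again absolutely
    continuous, the Lebesgue-Stieltjes measures of V and V - f are dominated by
    Lebesgue measure, and the Radon-Nikodym densities give an integrable h with
    f(v) - f(u) = int_u^v h; by Lebesgue differentiation f' = h almost everywhere. *)
Require Import Defs.
From HB Require Import structures.
From mathcomp Require Import all_boot all_order all_algebra.
From mathcomp Require Import all_classical all_reals all_analysis.
From mathcomp Require Import measurable_realfun ring lra.
Set Implicit Arguments. Unset Strict Implicit. Unset Printing Implicit Defensive.
Import Order.TTheory GRing.Theory Num.Theory.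
Import numFieldNormedType.Exports.
Local Open Scope classical_set_scope.
Local Open Scope ring_scope.

(** * Total variation of absolutely continuous functions *)

Section abs_cont.
Context {R : realType}.
Implicit Types (a b u v : R) (f g : R -> R) (s t : seq (R * R)).

(** Each increment of [g] is at most [N] times the increments of [f1] and [f2], and each of the two
    sums can be kept below [e / 2 / N]. Taking the identity for [f2] absorbs a Lipschitz term. *)
Lemma abs_cont_dominated a b f1 f2 g (M1 M2 : R) :
  (forall u v, a <= u -> u <= v -> v <= b ->
    `|g v - g u| <= M1 * `|f1 v - f1 u| + M2 * `|f2 v - f2 u|) ->
  abs_cont_on a b f1 -> abs_cont_on a b f2 -> abs_cont_on a b g.
Proof.
move=> gle ac1 ac2 e e0.
(* [N] bounds both constants whatever their signs; the 1 keeps it positive. *)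
pose N := 1 + `|M1| + `|M2|.
have N0 : 0 < N by rewrite /N -addrA ltr_pwDl// addr_ge0.
have eN0 : 0 < e / 2 / N by rewrite !divr_gt0.
have [d1 [d10 H1]] := ac1 _ eN0; have [d2 [d20 H2]] := ac2 _ eN0.
exists (Num.min d1 d2); split; first by rewrite lt_min d10.
move=> n u v uv dis; rewrite lt_min => /andP[/(H1 _ _ _ uv dis) S1 /(H2 _ _ _ uv dis) S2].
have M1N : M1 <= N.
  by rewrite (le_trans (ler_norm _))// /N; have := normr_ge0 M2; lra.
have M2N : M2 <= N.
  by rewrite (le_trans (ler_norm _))// /N; have := normr_ge0 M1; lra.
apply: (@le_lt_trans _ _ (N * \sum_(k < n) `|f1 (v k) - f1 (u k)| +
                          N * \sum_(k < n) `|f2 (v k) - f2 (u k)|)).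
  rewrite !mulr_sumr -big_split/=; apply: ler_sum => k _.
  have [auk [uvk vkb]] := uv k (ltn_ord k).
  by rewrite (le_trans (gle _ _ auk uvk vkb))// lerD// ler_wpM2r.
move: S1 S2; rewrite !ltr_pdivlMr// => S1 S2.
by move: S1 S2; rewrite ![_ * N]mulrC; lra.
Qed.

Lemma abs_cont_id a b : abs_cont_on a b (@id R).
Proof.
move=> e e0; exists e; split => // n u v uv _; apply: le_lt_trans.
apply: ler_sum => k _; rewrite ger0_norm// subr_ge0.
by have [_ []] := uv k (ltn_ord k).
Qed.

(* In a list of intervals, [p] stands for the interval from [p.2] to [p.1],
   the convention of [variation_zip]. *)
Definition itv_inside a b (p : R * R) := [&& a <= p.2, p.2 <= p.1 & p.1 <= b].
Definition itv_disjoint (p q : R * R) := (p.1 <= q.2) || (q.1 <= p.2).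

Lemma itv_disjoint_sym p q : itv_disjoint p q = itv_disjoint q p.
Proof. by rewrite /itv_disjoint orbC. Qed.

(** The list form lets partitions, which are lists, be concatenated with other intervals. *)
Lemma abs_cont_seq a b f : abs_cont_on a b f -> forall e, 0 < e ->
  exists2 d, 0 < d & forall s, all (itv_inside a b) s -> pairwise itv_disjoint s ->
    \sum_(p <- s) (p.1 - p.2) < d -> \sum_(p <- s) `|f p.1 - f p.2| < e.
Proof.
move=> acf e e0; have [d [d0 H]] := acf _ e0; exists d => // s sin sdis.
rewrite !(big_nth (0, 0)) !big_mkord.
apply: (H (size s) (fun k => (nth (0, 0) s k).2) (fun k => (nth (0, 0) s k).1)).
  by move=> k /(all_nthP (0,0) sin)/and3P[].
move=> j k js ks jk; apply/orP; rewrite -/(itv_disjoint _ _).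
have /(pairwiseP (0,0)) P := sdis.
case: (ltngtP j k) => [lt_jk|lt_kj|//]; first exact: P.
by rewrite itv_disjoint_sym; exact: P.
Qed.

Lemma itv_partition_inside u v l : itv_partition u v l ->
  all (itv_inside u v) (zip l (u :: l)).
Proof.
elim: l u => //= x l ih u uvl; have xl := itv_partition_cons uvl.
have ux : u < x by case: uvl => /= /andP[].
have xv : x <= v by exact: itv_partition_le xl.
apply/andP; split; first by rewrite /itv_inside/= lexx (ltW ux).
apply: (sub_all _ (ih _ xl)) => p /and3P[xp pp pv]; apply/and3P; split => //.
exact: le_trans (ltW ux) xp.
Qed.

Lemma itv_partition_disjoint u v l : itv_partition u v l ->
  pairwise itv_disjoint (zip l (u :: l)).
Proof.
elim: l u => //= x l ih u uvl; have xl := itv_partition_cons uvl.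
apply/andP; split; last exact: ih.
apply: (sub_all _ (itv_partition_inside xl)) => p /and3P[xp pp pv].
by rewrite /itv_disjoint/= xp.
Qed.

Lemma itv_partition_length u v l : itv_partition u v l ->
  \sum_(p <- zip l (u :: l)) (p.1 - p.2) = v - u.
Proof.
elim: l u => [|x l ih] u uvl.
  by rewrite (itv_partition_nil uvl) big_nil subrr.
by rewrite /= big_cons/= (ih _ (itv_partition_cons uvl)); lra.
Qed.

Lemma itv_inside_trans u v a b p : a <= u -> v <= b ->
  itv_inside u v p -> itv_inside a b p.
Proof.
move=> au vb /and3P[up pp pv]; apply/and3P; split => //.
  exact: le_trans au up.
exact: le_trans pv vb.
Qed.

Lemma itv_disjoint_sub p q r : itv_inside p.2 p.1 q -> itv_disjoint p r ->
  itv_disjoint q r.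
Proof.
move=> /and3P[pq qq qp] /orP[pr|rp]; apply/orP; [left|right].
  exact: le_trans qp pr.
exact: le_trans rp pq.
Qed.

(* The intervals of [s] are refined one at a time: each partition of the first
   one is moved to [t], whose increments are already controlled. *)
Lemma total_variation_small f a b (e d : R) :
  (forall s, all (itv_inside a b) s -> pairwise itv_disjoint s ->
    \sum_(p <- s) (p.1 - p.2) < d -> \sum_(p <- s) `|f p.1 - f p.2| < e) ->
  forall s t, all (itv_inside a b) (s ++ t) -> pairwise itv_disjoint (s ++ t) ->
    \sum_(p <- s ++ t) (p.1 - p.2) < d ->
  (\sum_(p <- s) total_variation p.2 p.1 f +
   (\sum_(p <- t) `|f p.1 - f p.2|)%:E <= e%:E)%E.
Proof.
move=> H; elim=> [t tin tdis tlen|[v u] s ih t].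
  by rewrite big_nil add0e lee_fin ltW// H.
rewrite cat_cons /= => /andP[uvin stin] /andP[uvdis stdis].
rewrite big_cons/= => len.
have [/= au uv vb] := and3P uvin.
rewrite big_cons /=.
set A := (\sum_(p <- s) _)%E; set B := (\sum_(p <- t) _).
have step l : itv_partition u v l -> (A + (variation u v f l + B)%:E <= e%:E)%E.
  move=> pl; rewrite (variation_zip _ pl) -big_cat/=.
  have lin := itv_partition_inside pl.
  apply: ih.
  - move: stin; rewrite !all_cat => /andP[-> ->]/=; rewrite andbT.
    by apply: (sub_all _ lin) => p; exact: itv_inside_trans.
  - move: uvdis stdis; rewrite !pairwise_cat !all_cat.
    move=> /andP[uvs uvt] /and3P[st -> ->]/=.
    rewrite (itv_partition_disjoint pl) /= andbT allrel_catr st andbT.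
    apply/andP; split; apply/allrelP => p q ps qs.
      rewrite itv_disjoint_sym; apply: (itv_disjoint_sub (p:=(v,u))).
        by have /allP := lin; apply.
      by have /allP := uvs; apply.
    apply: (itv_disjoint_sub (p:=(v,u))); first by have /allP := lin; apply.
    by have /allP := uvt; apply.
  - move: len; rewrite !big_cat/= (itv_partition_length pl); lra.
have A0 : (0 <= A)%E.
  rewrite /A big_seq; apply: sume_ge0 => p ps; apply: total_variation_ge0.
  by move: stin; rewrite all_cat => /andP[/allP/(_ _ ps)/and3P[]].
have : (A + B%:E <= e%:E)%E.
  apply: ih => //; move: len; rewrite /=; lra.
(* The bound just obtained makes [A] finite, so it can be moved to the other side before taking the
   supremum over the partitions of [[u, v]]. *)
have [Afin|] := boolP (A \is a fin_num); last first.
  rewrite ge0_fin_numE// ltey negbK => /eqP ->.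
  by rewrite addye// leye_eq.
have -> : A = (fine A)%:E by rewrite fineK.
rewrite -EFinD lee_fin => ABe.
rewrite -addeA -EFinD -leeBrDr// -EFinB.
apply: ge_ereal_sup => _ [_ [l pl <-] <-].
have := step _ pl; rewrite -(fineK Afin) -EFinD !lee_fin; lra.
Qed.

(** For the [d] that belongs to the tolerance 1, the variation over an interval shorter than [d] is
    at most 1, and finitely many such intervals cover [[a, b]]. *)
Lemma abs_cont_bounded_variation a b f : a <= b -> abs_cont_on a b f ->
  bounded_variation a b f.
Proof.
move=> ab acf; have [d d0 H] := abs_cont_seq acf ltr01.
apply/(bounded_variationP f ab).
have TV1 u v : a <= u -> u <= v -> v <= b -> v - u < d ->
    (total_variation u v f <= 1%:E)%E.
  move=> au uv vb uvd.
  have := total_variation_small H (s := [:: (v, u)]) (t := [::]).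
  rewrite /= !big_cons !big_nil/= !addr0 ?adde0; apply => //.
  by rewrite /itv_inside/= au uv vb.
have [n ban] : exists n : nat, (b - a) / (d / 2) < n%:R.
  have B0 : 0 <= (b - a) / (d / 2) by rewrite !divr_ge0 ?subr_ge0// ltW.
  by exists (Num.bound ((b - a) / (d / 2))); exact: archi_boundP.
(* Induction on the number of pieces; their length is [d / 2] because the bound needs a length
   strictly below [d]. *)
have key m c : a <= c -> c <= b -> c - a <= m%:R * (d / 2) ->
    (total_variation a c f <= (m%:R : R)%:E)%E.
  elim: m c => [|m ih] c ac cb.
    rewrite mul0r subr_le0 => ca.
    by rewrite (_ : c = a) ?total_variationxx//; apply/eqP; rewrite eq_le ca.
  rewrite -natr1 mulrDl mul1r => cam.
  pose c' := Num.max a (c - d / 2).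
  have ac' : a <= c' by rewrite /c' le_max lexx.
  have c'c : c' <= c by rewrite /c' ge_max ac /=; lra.
  rewrite (total_variationD _ ac' c'c) EFinD leeD//.
    apply: ih => //; first exact: le_trans cb.
    have m0 : 0 <= m%:R * (d/2) by rewrite mulr_ge0// divr_ge0 ?ltW.
    rewrite /c' lerBlDr ge_max; apply/andP; split; lra.
  apply: TV1 => //; have : c - d / 2 <= c' by rewrite /c' le_max lexx orbT.
  by lra.
rewrite ge0_fin_numE ?total_variation_ge0//; apply: (@le_lt_trans _ _ (n%:R : R)%:E).
  apply: key => //; rewrite -ler_pdivrMr ?divr_gt0//; exact: ltW.
by rewrite ltry.
Qed.

Lemma fine_total_variationB a b f u v : bounded_variation a b f ->
  a <= u -> u <= v -> v <= b ->
  (fine (total_variation a v f) - fine (total_variation a u f))%:E =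
  total_variation u v f.
Proof.
move=> bv au uv vb.
have av := le_trans au uv; have ub := le_trans uv vb.
have /(bounded_variationP f au) Fu := bounded_variationl au ub bv.
have /(bounded_variationP f av) Fv := bounded_variationl av vb bv.
rewrite EFinB !fineK// (total_variationD f au uv) addeAC subee// add0e.
by [].
Qed.

(** The increments of the variation function are the variations over the given intervals, and
    [total_variation_small] with an empty second list bounds their sum. That bound is weak, hence
    [e / 2]. *)
Lemma abs_cont_total_variation a b f : a <= b -> abs_cont_on a b f ->
  abs_cont_on a b (fun x => fine (total_variation a x f)).
Proof.
move=> ab acf e e0; have e20 : 0 < e / 2 by rewrite divr_gt0.
have bv := abs_cont_bounded_variation ab acf.
have [d d0 H] := abs_cont_seq acf e20; exists d; split => // n u v uv dis len.
pose s := [seq (v k, u k) | k <- iota 0 n].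
have big_s (S : nmodType) (F : R * R -> S) :
    \sum_(p <- s) F p = \sum_(k < n) F (v k, u k).
  by rewrite big_map -(big_mkord xpredT (fun k => F (v k, u k))) /index_iota subn0.
have sin : all (itv_inside a b) s.
  apply/allP => p /mapP[k]; rewrite mem_iota => /uv[? [? ?]] ->.
  exact/and3P.
have sdis : pairwise itv_disjoint s.
  apply/(pairwiseP (0,0)) => i j; rewrite !inE size_map size_iota => ni nj ij.
  rewrite !(nth_map 0%N) ?size_iota// !nth_iota// !add0n.
  by apply/orP/dis => // /eqP; rewrite lt_eqF.
have := total_variation_small H (s := s) (t := [::]).
rewrite cats0 !big_nil adde0 => /(_ sin sdis).
rewrite !big_s => /(_ len) TVe.
rewrite (@le_lt_trans _ _ (e / 2))//; last by lra.
rewrite -lee_fin; apply: le_trans TVe; rewrite -sumEFin; apply: lee_sum => k _.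
have [auk [uvk vkb]] := uv k (ltn_ord k).
rewrite -(fine_total_variationB bv auk uvk vkb) lee_fin ger0_norm//.
rewrite -lee_fin (fine_total_variationB bv auk uvk vkb).
exact: total_variation_ge0.
Qed.

End abs_cont.

(** * Lebesgue-Stieltjes measures of absolutely continuous functions *)

Section stieltjes.
Context {R : realType}.
Notation mu := (@lebesgue_measure R).

Lemma lebesgue_stieltjes_itv_oc (g : cumulative R R) (u v : R) : u <= v ->
  lebesgue_stieltjes_measure g `]u, v]%classic = (g v - g u)%:E.
Proof.
move=> uv; rewrite /lebesgue_stieltjes_measure /measure_extension.
rewrite measurable_mu_extE/=; last exact: is_ocitv.
by rewrite wlength_itv_bnd.
Qed.

Lemma lebesgue_itv_oc (u v : R) : u <= v -> mu `]u, v]%classic = (v - u)%:E.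
Proof.
move=> uv; rewrite lebesgue_measure_itv/= lte_fin.
by case: ltgtP uv => // -> _; rewrite subrr.
Qed.

Let grid (a b : R) (n k : nat) := a + k%:R * ((b - a) / n.+1%:R).

Let grid_le a b n j k : a <= b -> (j <= k)%N -> grid a b n j <= grid a b n k.
Proof.
by move=> ab jk; rewrite lerD2l ler_wpM2r ?ler_nat// divr_ge0 ?subr_ge0.
Qed.

Let grid0 a b n : grid a b n 0 = a. Proof. by rewrite /grid mul0r addr0. Qed.

Let gridn a b n : grid a b n n.+1 = b.
Proof. by rewrite /grid mulrCA divff ?mulr1 ?pnatr_eq0// addrC subrK. Qed.

Let in_grid a b n (x : R) m : a < x -> x <= grid a b n m ->
  exists2 k, (k < m)%N & x \in `]grid a b n k, grid a b n k.+1].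
Proof.
move=> ax; elim: m => [|m ih] xm; first by rewrite grid0 leNgt ax in xm.
have [/ih[k km xk]|mx] := leP x (grid a b n m).
  by exists k => //; exact: ltn_trans km _.
by exists m => //; rewrite in_itv/= mx xm.
Qed.

(** * Domination of the Stieltjes measure by Lebesgue measure *)

Section dominated.
Variables (g : cumulative R R) (a b : R).
Hypotheses (ab : a <= b) (acg : abs_cont_on a b g).
Local Notation LS := (lebesgue_stieltjes_measure g).

(* The cells of a regular grid of [a, b] that lie inside [U] form a finite
   family of disjoint intervals of total length less than [d]. *)
Let left_end n (k : nat) := grid a b n k.
(** A cell not inside [U] is collapsed to an empty interval instead of dropped, so the intervals
    stay indexed by all [k < n.+1]. *)
Let right_end (U : set R) n (k : nat) :=
  if `[< `]grid a b n k, grid a b n k.+1] `<=` U >]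
  then grid a b n k.+1 else grid a b n k.
Let cell U n (k : nat) := `]left_end n k, right_end U n k]%classic.

Let left_right U n k : left_end n k <= right_end U n k <= grid a b n k.+1.
Proof.
by rewrite /left_end /right_end; case: ifP => _; rewrite lexx ?andbT ?grid_le.
Qed.

Let cell_sub U n k : cell U n k `<=` U.
Proof.
rewrite /cell /left_end /right_end; case: ifPn => [/asboolP//|_ x].
by rewrite set_itvoc0.
Qed.

Let cell_disjoint U n j k : j <> k ->
  right_end U n j <= left_end n k \/ right_end U n k <= left_end n j.
Proof.
move=> /eqP; rewrite neq_ltn => /orP[jk|kj]; [left|right];
 [have /andP[_] := left_right U n j|have /andP[_] := left_right U n k];
 move=> /le_trans; apply; exact: grid_le.
Qed.

Let trivIset_cell U n : trivIset setT (cell U n).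
Proof.
apply/trivIsetP => j k _ _ /eqP jk; rewrite -subset0 => x; rewrite /cell => -[]/=.
rewrite !in_itv/= => /andP[lj xj] /andP[lk xk].
case: (cell_disjoint U n jk) => H.
  by have := lt_le_trans lk (le_trans xj H); rewrite ltxx.
by have := lt_le_trans lj (le_trans xk H); rewrite ltxx.
Qed.

Let cells U n := \big[setU/set0]_(k < n.+1) cell U n k.

Let mcells U n : measurable (cells U n).
Proof. by apply: bigsetU_measurable => k _; exact: measurable_itv. Qed.

Let cells_sub U n : cells U n `<=` U.
Proof. by rewrite /cells -bigcup_mkord => x [k _] /cell_sub. Qed.

(** The cells are disjoint and lie in [U], so their lengths add up to less than [d]; their Stieltjes
    measure is the sum of the increments of [g]. *)
Let LS_cells U n (e d : R) : measurable U -> (mu U < d%:E)%E ->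
  (forall n (u v : nat -> R),
      (forall k, (k < n)%N -> a <= u k /\ u k <= v k /\ v k <= b) ->
      (forall j k, (j < n)%N -> (k < n)%N -> j <> k -> v j <= u k \/ v k <= u j) ->
      \sum_(k < n) (v k - u k) < d ->
      \sum_(k < n) `|g (v k) - g (u k)| < e) ->
  (LS (cells U n) <= e%:E)%E.
Proof.
move=> mU Ud H.
have lr k : left_end n k <= right_end U n k by case/andP: (left_right U n k).
have : \sum_(k < n.+1) (right_end U n k - left_end n k) < d.
  rewrite -lte_fin -sumEFin; apply: le_lt_trans Ud.
  under eq_bigr do rewrite -lebesgue_itv_oc//.
  rewrite -(measure_semi_additive_ord_I mu (F := cell U n)).
  - by apply: le_measure; rewrite ?inE//; [exact: mcells|exact: cells_sub].
  - by move=> k _; exact: measurable_itv.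
  - by move=> i j _ _; exact: trivIset_cell.
  - exact: mcells.
move=> S; have {}S := H _ _ _ _ _ S.
have -> : LS (cells U n) = (\sum_(k < n.+1) LS (cell U n k))%E.
  apply: (measure_semi_additive_ord_I LS (F := cell U n)).
  - by move=> k _; exact: measurable_itv.
  - by move=> i j _ _; exact: trivIset_cell.
  - exact: mcells.
under eq_bigr do rewrite /cell lebesgue_stieltjes_itv_oc//.
rewrite sumEFin lee_fin; apply: le_trans (ltW (S _ _)).
- by apply: ler_sum => k _; exact: ler_norm.
- move=> k kn; split; first by rewrite -[leLHS](grid0 a b n) grid_le.
  split; first exact: lr.
  have /andP[_ /le_trans] := left_right U n k; apply.
  by rewrite -[leRHS](gridn a b n) grid_le.
- by move=> j k _ _; exact: cell_disjoint.
Qed.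

(** An open [U] of measure below [d] contains [A], and each point of [U] in []a, b]] is in the cells
    of all fine enough grids. So the set lies in the lower limit of the cells, whose measure is at
    most [e]. *)
Let LS_null A : measurable A -> mu A = 0 -> LS (A `&` `]a, b]) = 0.
Proof.
move=> mA A0; apply/eqP; rewrite eq_le measure_ge0 andbT.
apply/lee_addgt0Pr => e e0; rewrite add0e.
have [d [d0 H]] := acg e0.
have [U [oU AU UAd]] : exists U : set R, [/\ open U , A `<=` U & mu (U `\` A) < d%:E]%E.
  have Afin : (mu A < +oo)%E by rewrite A0.
  exact: lebesgue_regularity_outer mA Afin d0.
have mU : measurable U by exact: open_measurable.
have Ud : (mu U < d%:E)%E.
  have mUA : measurable (U `\` A) by exact: measurableD.
  have := measureU2 mu mA mUA; rewrite [X in (_ <= X + _)%E -> _]A0 add0e setDUK// => UA.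
  exact: le_lt_trans UA UAd.
(* Successive regular grids are not nested; these intersections increase with [n], which allows
   continuity from below. *)
pose W n := \bigcap_(m in [set m | (n <= m)%N]) cells U m.
have mW n : measurable (W n) 
  by apply: bigcap_measurable => [|k _]; [exists n => /=|exact: mcells].
have We n : (LS (W n) <= e%:E)%E.
  apply: (@le_trans _ _ (LS (cells U n))); last exact: (@LS_cells U n e d mU Ud H).
  apply: le_measure; rewrite ?inE; [exact: mW|exact: mcells|].
  by move=> x; apply => /=.
have mbW : measurable (\bigcup_n W n) by exact: bigcup_measurable.
have ndW : nondecreasing_seq W.
  by move=> m n mn; apply/subsetPset => x Wx k /= nk; apply: Wx => /=; exact: leq_trans nk.
have cW := nondecreasing_cvg_mu mW mbW ndW (mu := LS).
apply: (@le_trans _ _ (LS (\bigcup_n W n))); last first.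
  have <- : limn (LS \o W) = LS (\bigcup_n W n) by exact: cvg_lim.
  apply: lime_le; first by apply/cvg_ex; eexists; exact: cW.
  by apply: nearW => n; exact: We.
apply: le_measure; rewrite ?inE; [exact: measurableI|exact: mbW|].
move=> x [Ax]; rewrite /= in_itv/= => /andP[ax xb].
have /nbhs_ballP[r /= r0 xrU] : nbhs x U by apply: open_nbhs_nbhs; split => //; exact: AU.
(* From this index on the mesh is below [r], so the cell around [x] stays in the ball and hence in
   [U]. *)
have [N Nr] : exists N : nat, (b - a) / r < N%:R.
  exists (Num.bound ((b - a) / r)); apply: archi_boundP.
  by rewrite divr_ge0 ?subr_ge0// ltW.
exists N => // m /= Nm; rewrite /cells -bigcup_mkord.
have [|k km xk] := @in_grid a b m x m.+1 ax; first by rewrite gridn.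
exists k => //; rewrite /cell /left_end /right_end asboolT//.
move: xk; rewrite /= in_itv/= => /andP[kx xk1] y.
rewrite /= in_itv/= => /andP[ky yk1]; apply: xrU; rewrite /ball/=.
have : grid a b m k.+1 - grid a b m k < r.
  have -> : grid a b m k.+1 - grid a b m k = (b - a) / m.+1%:R.
    by rewrite /grid -(natr1 k); set w := (b - a) / _; ring.
  rewrite ltr_pdivrMr// -ltr_pdivrMl// mulrC (lt_le_trans Nr)// ler_nat.
  by rewrite (leq_trans Nm).
by move=> gr; rewrite ltr_norml; apply/andP; split; lra.
Qed.

Lemma lebesgue_stieltjes_density :
  exists h : R -> R, mu.-integrable setT (EFin \o h) /\
    forall u v, a <= u -> u <= v -> v <= b ->
      g v - g u = \int[mu]_(t in `]u, v]) h t.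
Proof.
have mab : measurable (`]a, b]%classic : set (measurableTypeR R)) by exact: measurable_itv.
have LSab : (LS `]a, b]%classic < +oo)%E by rewrite lebesgue_stieltjes_itv_oc// ltry.
(* Restricting to []a, b]] makes the measure finite, and domination is established there. *)
pose nu : {finite_measure set (measurableTypeR R) -> \bar R} := mfrestr mab LSab.
have dom : nu `<< mu.
  by apply/null_content_dominatesP => A mA A0; exact: LS_null.
have [h [h0 hfin inth hE]] := radon_nikodym_sigma_finite dom.
exists (fine \o h); split.
  by apply: eq_integrable inth => // x _ /=; rewrite fineK.
move=> u v au uv vb; apply/EFin_inj.
rewrite -lebesgue_stieltjes_itv_oc// /Rintegral fineK.
  rewrite (eq_integral h); last by move=> x _ /=; rewrite fineK.
  rewrite -hE; last exact: measurable_itv.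
  rewrite /nu/= /mfrestr /mrestr/=; congr (LS _); apply/esym/setIidPl.
  by move=> x; rewrite /= !in_itv/= => /andP[ux xv]; lra.
apply: integrable_fin_num; first exact: measurable_itv.
apply: (integrableS measurableT) => //.
by apply: eq_integrable inth => // x _ /=; rewrite fineK.
Qed.

End dominated.
End stieltjes.

(** * Fundamental theorem of calculus for absolutely continuous functions *)

Section clamp.
Context {R : realType}.
Implicit Types (a b : R) (f g : R -> R).

(** Composing with [clamp a b] extends a function from [[a, b]] by constants and keeps continuity
    and monotonicity, as needed for cumulative functions and for the measurability of derivatives on
    the whole line. *)
Definition clamp a b (x : R) := Num.min (Num.max a x) b.

Lemma clamp_in a b x : a <= b -> a <= clamp a b x <= b.
Proof. by move=> ab; rewrite /clamp le_min ge_min lexx orbT ab le_max lexx. Qed.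

Lemma clamp_id a b x : a <= x -> x <= b -> clamp a b x = x.
Proof.
move=> ax xb; rewrite /clamp; move/max_idPr : ax => ->.
by move/min_idPl : xb.
Qed.

Lemma clamp_le a b x y : x <= y -> clamp a b x <= clamp a b y.
Proof.
move=> xy; rewrite /clamp le_min !ge_min lexx orbT andbT.
by rewrite ge_max !le_max lexx xy orbT.
Qed.

Lemma clamp_lip a b x y : x <= y -> clamp a b y - clamp a b x <= y - x.
Proof.
move=> xy; rewrite /clamp lerBlDr ge_min; have [xb|bx] := leP (Num.max a x) b.
  rewrite ge_max; apply/orP; left; apply/andP; split.
    by have : a <= Num.max a x by [rewrite le_max lexx|]; lra.
  by have : x <= Num.max a x by [rewrite le_max lexx orbT|]; lra.
by apply/orP; right; lra.
Qed.

Lemma abs_cont_unif a b f : abs_cont_on a b f -> forall e, 0 < e ->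
  exists2 d, 0 < d & forall u v, a <= u -> u <= v -> v <= b -> v - u < d ->
    `|f v - f u| < e.
Proof.
move=> acf e e0; have [d [d0 H]] := acf e e0; exists d => // u v au uv vb uvd.
have := H 1%N (fun=> u) (fun=> v); rewrite !big_ord1; apply => //.
by move=> [|j] [|k].
Qed.

Lemma continuous_clamp a b f : a <= b -> abs_cont_on a b f ->
  continuous (f \o clamp a b).
Proof.
move=> ab acf x; apply/cvgrPdist_lt => e e0.
have [d d0 H] := abs_cont_unif acf e0.
have key y z : y <= z -> z - y < d ->
    `|f (clamp a b z) - f (clamp a b y)| < e.
  move=> yz zyd; have /andP[ay _] := clamp_in y ab; have /andP[_ bz] := clamp_in z ab.
  apply: H => //; first exact: clamp_le.
  exact: le_lt_trans (clamp_lip _ _ yz) zyd.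
near=> y; have : `|x - y| < d by near: y; exact: cvgr_dist_lt.
have [xy|yx] := leP x y.
  by rewrite distrC ger0_norm ?subr_ge0// => yxd; rewrite distrC /=; exact: key.
by rewrite ger0_norm ?subr_ge0 ?ltW// => yxd /=; apply: key => //; exact: ltW.
Unshelve. all: by end_near. Qed.

Notation mu := (@lebesgue_measure R).

Lemma nondecreasing_abs_cont_density a b g : a <= b -> abs_cont_on a b g ->
  (forall u v, a <= u -> u <= v -> v <= b -> g u <= g v) ->
  exists h : R -> R, mu.-integrable setT (EFin \o h) /\
    forall u v, a <= u -> u <= v -> v <= b ->
      g v - g u = \int[mu]_(t in `]u, v]) h t.
Proof.
move=> ab acg ndg; pose gc := g \o clamp a b.
have ndgc : nondecreasing gc.
  move=> x y xy; have /andP[ax _] := clamp_in x ab; have /andP[_ yb] := clamp_in y ab.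
  by apply: ndg => //; exact: clamp_le.
have rcgc : right_continuous gc.
  by apply: right_continuousW; exact: continuous_clamp.
pose B := isCumulative.Build R _ R gc ndgc rcgc.
pose G : cumulative R R := HB.pack gc B.
have gcE x : a <= x -> x <= b -> G x = g x.
  by move=> ax xb; rewrite /G/= /gc /= clamp_id.
have acG : abs_cont_on a b G.
  apply: (abs_cont_dominated (M1 := 1) (M2 := 0) _ acg acg) => u v au uv vb.
  by rewrite !gcE ?(le_trans au uv) ?(le_trans uv vb)// mul1r mul0r addr0.
have [h [inth hE]] := lebesgue_stieltjes_density ab acG.
exists h; split => // u v au uv vb; rewrite -hE// !gcE ?(le_trans au uv) ?(le_trans uv vb)//.
Qed.

Lemma abs_cont_density a b f : a <= b -> abs_cont_on a b f ->
  exists h : R -> R, mu.-integrable setT (EFin \o h) /\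
    forall u v, a <= u -> u <= v -> v <= b ->
      f v - f u = \int[mu]_(t in `]u, v]) h t.
Proof.
move=> ab acf; have acV := abs_cont_total_variation ab acf.
have bv := abs_cont_bounded_variation ab acf.
set V := (fun x => _) in acV.
have VE u v : a <= u -> u <= v -> v <= b -> `|f v - f u| <= V v - V u.
  move=> au uv vb; rewrite -lee_fin (fine_total_variationB bv)//.
  exact: total_variation_ge.
have acN : abs_cont_on a b (fun x => V x - f x).
  apply: (abs_cont_dominated (M1 := 1) (M2 := 1) _ acV acf) => u v au uv vb.
  rewrite !mul1r (le_trans _ (ler_normB _ _))//.
  by rewrite le_eqVlt; apply/orP; left; apply/eqP; congr `|_|; ring.
have [h1 [int1 h1E]] := nondecreasing_abs_cont_density ab acV
  (fun u v au uv vb => ltac:(by rewrite -subr_ge0; exact: le_trans (VE u v au uv vb))).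
have [|h2 [int2 h2E]] := nondecreasing_abs_cont_density ab acN.
  move=> u v au uv vb; have := le_trans (ler_norm _) (VE u v au uv vb); lra.
exists (fun x => h1 x - h2 x); split.
  have := integrableB measurableT int1 int2; apply: eq_integrable => //.
move=> u v au uv vb; rewrite RintegralB//.
- by rewrite -h1E// -h2E//; ring.
- exact: integrableS int1.
- exact: integrableS int2.
Qed.

Lemma abs_cont_derive_density a b f : a < b -> abs_cont_on a b f ->
  exists h : R -> R, [/\ mu.-integrable `[a, b] (EFin \o h),
    f b - f a = \int[mu]_(t in `[a, b]) h t &
    {ae mu, forall t, t \in `]a, b[ -> is_derive t 1 f (h t)}].
Proof.
move=> ab acf; have [h [inth hE]] := abs_cont_density (ltW ab) acf.
have intE u : a <= u -> u <= b -> f u - f a = \int[mu]_(t in `[a, u]) h t.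
  move=> au ub; rewrite hE// Rintegral_itv_obnd_cbnd//.
  by apply: integrableS inth.
have ih (A : set (measurableTypeR R)) : measurable A -> mu.-integrable A (EFin \o h).
  by move=> mA; apply: integrableS inth.
exists h; split; [exact: ih|exact: intE (ltW ab) _|].
have loch : locally_integrable setT h.
  by have := integrable_locally measurableT inth; rewrite patch_setT.
have := FTC1 (a := BLeft a) (fun y => ih _ (measurable_itv _)) loch.
apply: filterS; first exact: (ae_filter_ringOfSetsType mu).
move=> t Ft tab; move: (tab); rewrite in_itv/= => /andP[at_ tb].
have [|dF DF] := Ft; first by rewrite lte_fin.
set F := (fun x => _) in dF DF.
have dF1 : is_derive t 1 F (h t).
  exact: DeriveDef dF (etrans (esym (derive1E F t)) DF).
(* Near an interior point [f] is the indefinite integral of [h] plus the constant [f a]. *)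
apply: (near_eq_is_derive (f := fun x => F x + f a)); last first.
  by rewrite -[h t]addr0; exact: is_deriveD.
near=> x; have : x \in `]a, b[ by near: x; exact: near_in_itvoo.
by rewrite in_itv/= => /andP[ax xb]; rewrite /F -intE ?ltW// subrK.
Unshelve. all: by end_near. Qed.

(** Both [k] and the density of [f] are derivatives of [f] almost everywhere, so they agree almost
    everywhere. Such agreement does not make [k] Borel measurable, so this is a hypothesis. *)
Lemma abs_cont_FTC a b f (k : R -> R) : a <= b -> abs_cont_on a b f ->
  measurable_fun `]a, b[ k ->
  {ae mu, forall t, t \in `]a, b[ -> is_derive t 1 f (k t)} ->
  mu.-integrable `[a, b] (EFin \o k) /\ \int[mu]_(t in `[a, b]) k t = f b - f a.
Proof.
move=> ab acf mk kE.
have {}mk : measurable_fun `[a, b] k by exact: measurable_fun_itv_cc mk.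
have mab : measurable (`[a, b]%classic : set (measurableTypeR R)).
  exact: measurable_itv.
suff [h [inth fE hk]] : exists h : R -> R, [/\ mu.-integrable `[a, b] (EFin \o h),
    f b - f a = \int[mu]_(t in `[a, b]) h t &
    ae_eq mu `[a, b]%classic (EFin \o h) (EFin \o k)].
  have [mh _] := integrableP _ _ _ inth.
  have mk' : measurable_fun `[a, b] (EFin \o k) by exact/measurable_EFinP.
  split; last by rewrite fE /Rintegral; congr fine; apply/esym; exact: ae_eq_integral.
  apply/integrableP; split => //.
  have <- : (\int[mu]_(t in `[a, b]) `|(EFin \o h) t| =
             \int[mu]_(t in `[a, b]) `|(EFin \o k) t|)%E.
    apply: ae_eq_integral => //; first exact: measurableT_comp.
      exact: measurableT_comp.
    exact: ae_eq_abse.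
  by case/integrableP : inth.
have [{}ab|ba] := ltP a b; last first.
  have -> : b = a by apply/eqP; rewrite eq_le ba ab.
  exists (cst 0); split.
  - exact: integrable0.
  - by rewrite Rintegral_cst ?mul0r ?subrr.
  - by apply: ae_eq0 => //; rewrite set_itv1; exact: lebesgue_measure_set1.
have [h [inth fE hd]] := abs_cont_derive_density ab acf.
exists h; split => //.
(* The derivatives are given on the open interval only; the end points are discarded as a null
   set. *)
have nab : mu.-negligible [set t | t = a \/ t = b].
  exists ([set a] `|` [set b]); split => //; first by apply: measurableU.
  rewrite measureU0 //; exact: lebesgue_measure_set1.
have nabs : {ae mu, forall t, ~ (t = a \/ t = b)}.
  by rewrite /almost_everywhere; apply: negligibleS nab => t /= /contrapT.
apply: (@filterS3 _ _ (ae_filter_ringOfSetsType mu) _ _ _ _ _ hd kE nabs).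
move=> t ht kt tab /=; rewrite in_itv/= => /andP[a_t tb].
have tin : t \in `]a, b[.
  by rewrite in_itv/= !lt_neqAle a_t tb !andbT; apply/andP; split; apply/eqP => ?; apply: tab; [left|right].
by have [_ <-] := ht tin; have [_ <-] := kt tin.
Qed.

End clamp.

(** * Borel measurability of the derivative *)

Section derive1_measurable.
Context {R : realType}.
Variable f : R -> R.
Hypothesis cf : continuous f.
Let q (h x : R) : R := h^-1 *: (f (h + x) - f x).

Let cq h : continuous (q h).
Proof.
move=> x; apply: cvgZr; apply: cvgB; last exact: cf.
apply: continuous_comp; last exact: cf.
by apply: cvgD; [exact: cvg_cst|exact: cvg_id].
Qed.

(* Quantifying over all real increments makes [C k n] an intersection of closed
   sets, and [D] is the set of differentiability points by the Cauchy criterion. *)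
Let C (k n : nat) : set R := [set x | forall h h' : R,
  0 < `|h| < n.+1%:R^-1 -> 0 < `|h'| < n.+1%:R^-1 ->
  `|q h x - q h' x| <= k.+1%:R^-1].

Let closed_C k n : closed (C k n).
Proof.
rewrite (_ : C k n = \bigcap_(p in [set p : R * R |
    0 < `|p.1| < n.+1%:R^-1 /\ 0 < `|p.2| < n.+1%:R^-1])
    ((fun x => `|q p.1 x - q p.2 x|) @^-1` [set y | y <= k.+1%:R^-1])).
  apply: closed_bigI => p _; apply: closed_comp; last exact: closed_le.
  move=> x _; apply: (@continuous_comp _ _ _ (fun x => q p.1 x - q p.2 x)).
    by apply: cvgB; exact: cq.
  exact: norm_continuous.
apply/seteqP; split => [x Cx [h h'] /= []|x Hx h h' hn h'n]; first exact: Cx.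
by have := Hx (h, h'); apply.
Qed.

Let D : set R := [set x | cvg (q h x @[h --> 0^'])].

Let DE : D = \bigcap_k \bigcup_n C k n.
Proof.
apply/seteqP; split => x.
  move=> /cvg_ex[l ql] k _.
  have k0 : 0 < k.+1%:R^-1 / 2 :> R by rewrite divr_gt0.
  have /cvgrPdist_lt/(_ _ k0) := ql.
  rewrite near_withinE => /nbhs_ballP[d /= d0 H].
  have [n nd] : exists n : nat, n.+1%:R^-1 < d.
    exists (Num.bound d^-1); rewrite -[ltRHS]invrK ltf_pV2 ?posrE ?invr_gt0//.
    rewrite (lt_le_trans (archi_boundP _))//; first by rewrite invr_ge0 ltW.
    by rewrite ler_nat.
  exists n => // h h'.
  have Hh e : 0 < `|e| < n.+1%:R^-1 -> `|l - q e x| < k.+1%:R^-1 / 2.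
    move=> /andP[e0 en]; apply: H; last by rewrite -normr_gt0.
    by rewrite /ball/= sub0r normrN (lt_trans en nd).
  move=> /Hh h1 /Hh h2.
  rewrite (_ : q h x - q h' x = (l - q h' x) - (l - q h x)); last by ring.
  by rewrite (le_trans (ler_normB _ _))// [leRHS]splitr lerD// ltW.
move=> Hx; apply: cauchy_cvg; apply: cauchy_exP => e e0.
have [k ke] : exists k : nat, k.+1%:R^-1 < e.
  exists (Num.bound e^-1); rewrite -[ltRHS]invrK ltf_pV2 ?posrE ?invr_gt0//.
  rewrite (lt_le_trans (archi_boundP _))//; first by rewrite invr_ge0 ltW.
  by rewrite ler_nat.
have [n _ Cx] := Hx k I.
(* Any nonzero increment below [n.+1%:R^-1] would do: its quotient is the centre of the Cauchy
   ball. *)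
pose h0 : R := n.+1%:R^-1 / 2.
have n0 : 0 < n.+1%:R^-1 :> R by rewrite invr_gt0.
have h00 : 0 < h0 by rewrite divr_gt0.
exists (q h0 x); change (\forall h \near 0^', ball (q h0 x) e (q h x)).
rewrite near_withinE; near=> h => hneq0.
rewrite /ball/=; apply: le_lt_trans ke; apply: Cx.
  by rewrite gtr0_norm// h00 /h0 ltr_pdivrMr// ltr_pMr// ltr1n.
rewrite normr_gt0 hneq0/=; near: h.
by apply/nbhs_ballP; exists n.+1%:R^-1 => //= z; rewrite /ball/= sub0r normrN.
Unshelve. all: by end_near. Qed.

Let mq h : measurable_fun setT (q h).
Proof. exact: continuous_measurable_fun. Qed.

Lemma measurable_derive1 : measurable_fun setT (derive1 f : R -> R).
Proof.
have mD : measurable D.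
  rewrite DE; apply: bigcapT_measurable => k; apply: bigcupT_measurable => n.
  exact: closed_measurable.
have mDC : measurable (~` D) by exact: measurableC.
rewrite -(setUv D); apply/measurable_funU => //; split.
  (* On [D] the derivative is the pointwise limit of continuous quotients along the increments
     [1 / n.+1]. *)
  apply: (measurable_fun_cvg (h := fun n => q n.+1%:R^-1)).
    by move=> n; exact: measurable_funS (mq _).
  move=> x Dx; apply: (proj1 (cvgr_dnbhsP (q^~ x) 0 _) Dx).
  by split=> [n|]; [rewrite invr_neq0|exact: cvg_harmonic].
(* Where the quotients diverge, [derive1] takes the default value [point], so it is constant off
   [D]. *)
apply: (eq_measurable_fun (cst (point : R))) => // x; rewrite inE => nDx.
by apply/esym; exact: (dvgP nDx).
Qed.

End derive1_measurable.

(** * Quotients by functions of class C1 *)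

Section C1.
Context {R : realType}.
Implicit Types (A : set R) (g dg : R -> R).

(** Near [t] the difference quotients are within 1 of [dg t], hence bounded by [K], and increments
    of [g] are at most [K] times the distance. *)
Lemma deriv_within_continuous A g dg :
  deriv_within A g dg -> {within A, continuous g}.
Proof.
move=> gdg; apply/subspace_continuousP => t At; apply/cvgrPdist_lt => e e0.
pose K := `|dg t| + 1.
have K0 : 0 < K by rewrite /K ltr_wpDl.
have eK : 0 < e / K by exact: divr_gt0.
have /cvgrPdist_lt/(_ _ ltr01) := gdg t At; rewrite !near_withinE => H.
near=> y => Ay; have yd : `|t - y| < e / K by near: y; exact: cvgr_dist_lt.
have [->|yt] := eqVneq y t; first by rewrite subrr normr0.
have q1 : `|dg t - (g y - g t) / (y - t)| < 1.
  have : (A `\ t) y by split => //; exact/eqP.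
  by near: y; exact: H.
have yt0 : y - t != 0 by rewrite subr_eq0.
have qK : `|(g y - g t) / (y - t)| <= K.
  have := ler_dist_dist (dg t) ((g y - g t) / (y - t)).
  rewrite /K; move: q1; set a := `|dg t|; set c := `|_ - _|; set d := `|_ / _|.
  by rewrite ler_norml => q1 /andP[? ?]; lra.
rewrite distrC -[g y - g t](divfK yt0) normrM.
rewrite (le_lt_trans (ler_wpM2r _ qK))// mulrC -ltr_pdivlMr// distrC.
Unshelve. all: by end_near. Qed.

Lemma deriv_within_is_derive A g dg t :
  deriv_within A g dg -> nbhs t A -> is_derive t 1 g (dg t).
Proof.
move=> gdg nA.
suff H : h^-1 *: (g (h + t) - g t) @[h --> 0^'] --> dg t.
  have dgE : derive1 g t = dg t by exact: cvg_lim.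
  apply: DeriveDef; last by rewrite -derive1E.
  have : cvg (h^-1 *: (g (h + t) - g t) @[h --> 0^']) by apply/cvg_ex; exists (dg t).
  rewrite /derivable; set a := (fun _ => _); set b := (fun _ => _).
  by have -> : b = a by apply/funext => h; rewrite /a /b /= [h%:A]mulr1.
have At : A t by exact: nbhs_singleton nA.
apply/cvgrPdist_lt => e e0; have /cvgrPdist_lt/(_ _ e0) := gdg t At.
rewrite !near_withinE => /nbhs_ballP[d /= d0 H].
have /nbhs_ballP[r /= r0 rA] := nA.
have H0 k : 0 < k -> \forall h \near (0 : R), `|h| < k.
  by move=> k0; apply/nbhs_ballP; exists k => // z; rewrite /ball/= sub0r normrN.
near=> h => h0.
have hd : `|h| < d by near: h; exact: H0.
have hr : `|h| < r by near: h; exact: H0.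
have ball_h k : `|h| < k -> ball t k (h + t).
  by rewrite /ball/= opprD addrCA subrr addr0 normrN.
have := H (h + t) (ball_h _ hd); rewrite addrK /= => Hh.
rewrite -[_ *: _]/(_ * _) mulrC; apply: Hh; split; first exact/rA/ball_h.
by rewrite /= => /eqP; rewrite -subr_eq0 addrK (negbTE h0).
Unshelve. all: by end_near. Qed.

Lemma within_continuous_bounded (a b : R) g : {within `[a, b], continuous g} ->
  exists2 M, 0 <= M & forall t, a <= t -> t <= b -> `|g t| <= M.
Proof.
move=> cg.
have [M [_ HM]] := compact_bounded (continuous_compact cg (@segment_compact _ a b)).
(* Boundedness gives every number strictly above [M] as a bound; the absolute value makes the chosen
   one nonnegative. *)
exists `|M + 1| => // t at_ tb; apply: (HM `|M + 1|).
  by rewrite (lt_le_trans _ (ler_norm _))// ltrDl.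
by exists t => //=; rewrite in_itv/= at_ tb.
Qed.

Lemma within_continuousV A g : (forall t, A t -> g t != 0) ->
  {within A, continuous g} -> {within A, continuous (fun t => (g t)^-1)}.
Proof.
move=> g0 /subspace_continuousP cg; apply/subspace_continuousP => t At.
by apply: cvgV; [exact: g0|exact: cg].
Qed.

Lemma itv_nbhs (A : set R) (a b t : R) : `[a, b] `<=` A -> t \in `]a, b[ -> nbhs t A.
Proof.
move=> abA tab; apply: filterS (near_in_itvoo tab) => z zab; apply: abA.
exact: subset_itv_oo_cc zab.
Qed.

Lemma C1_on_lipschitz A (a b : R) g dg : C1_on A g dg -> `[a, b] `<=` A ->
  exists2 M, 0 <= M &
    forall u v, a <= u -> u <= v -> v <= b -> `|g v - g u| <= M * `|v - u|.
Proof.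
move=> [gdg cdg] abA; have cg := deriv_within_continuous gdg.
have [M M0 HM] := within_continuous_bounded (continuous_subspaceW abA cdg).
exists M => // u v au uv vb.
have uvA : `[u, v] `<=` A.
  by move=> t; rewrite /= in_itv/= => /andP[ut tv]; apply: abA; rewrite /= in_itv/=; lra.
have [|c] := MVT_segment uv _ (continuous_subspaceW uvA cg) (df := dg).
  by move=> t tuv; apply: deriv_within_is_derive gdg _; exact: itv_nbhs tuv.
rewrite in_itv/= => /andP[uc cv] ->; rewrite normrM ler_wpM2r// HM//.
  exact: le_trans uc.
exact: le_trans vb.
Qed.

Lemma abs_cont_within_continuous (a b : R) f : a <= b -> abs_cont_on a b f ->
  {within `[a, b], continuous f}.
Proof.
move=> ab acf; have cc := continuous_clamp ab acf.
apply: (@subspace_eq_continuous _ _ _ (f \o clamp a b)).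
  by move=> t; rewrite inE /= in_itv/= => /andP[? ?] /=; rewrite clamp_id.
exact: continuous_subspaceT.
Qed.

Notation mu := (@lebesgue_measure R).

(** The integrand [k] is the quotient rule for [(f - m * chi) / psi]. Keeping [m] and [psi] general
    covers the integrals of both conditions and of both representation formulas. *)
Lemma quotient_FTC A (x y : R) f chi dchi psi dpsi (m : R) :
  C1_on A chi dchi -> C1_on A psi dpsi -> `[x, y] `<=` A ->
  (forall t, x <= t -> t <= y -> psi t != 0) -> x <= y -> abs_cont_on x y f ->
  let k := fun t => ((derive1 f t - m * dchi t) * psi t -
                     (f t - m * chi t) * dpsi t) / psi t ^+ 2 in
  mu.-integrable `[x, y] (EFin \o k) /\
  \int[mu]_(t in `[x, y]) k t =
    (f y - m * chi y) / psi y - (f x - m * chi x) / psi x.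
Proof.
move=> C1chi C1psi xyA psi0 xy acf k.
have [[dgchi cdchi] [dgpsi cdpsi]] := (C1chi, C1psi).
have cchi := continuous_subspaceW xyA (deriv_within_continuous dgchi).
have cpsi := continuous_subspaceW xyA (deriv_within_continuous dgpsi).
have cf := abs_cont_within_continuous xy acf.
have {}psi0 t : t \in `[x, y] -> psi t != 0.
  by rewrite in_itv/= => /andP[? ?]; exact: psi0.
have cV : {within `[x, y], continuous (fun t => (psi t)^-1)}.
  by apply: within_continuousV => // t /= ?; exact: psi0.
apply: (abs_cont_FTC (f := fun t => (f t - m * chi t) / psi t)) => //.
- have [L L0 HL] := C1_on_lipschitz C1chi xyA.
  have [P P0 HP] := within_continuous_bounded cV.
  have [K K0 HK] := C1_on_lipschitz C1psi xyA.
  pose u t := f t - m * chi t.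
  have acu : abs_cont_on x y u.
    apply: (abs_cont_dominated (M1 := 1) (M2 := `|m| * L) _ acf (@abs_cont_id R x y)).
    move=> v w xv vw wy; rewrite mul1r -mulrA /u.
    rewrite (_ : _ - _ = (f w - f v) - m * (chi w - chi v)); last by ring.
    by rewrite (le_trans (ler_normB _ _))// lerD// normrM ler_wpM2l// HL.
  have [B B0 HB] := within_continuous_bounded (abs_cont_within_continuous xy acu).
  apply: (abs_cont_dominated (M1 := P) (M2 := B * (P * P * K)) _ acu (@abs_cont_id R x y)).
  move=> v w xv vw wy; have vy := le_trans vw wy; have xw := le_trans xv vw.
  have v0 : psi v != 0 by apply: psi0; rewrite in_itv/= xv vy.
  have w0 : psi w != 0 by apply: psi0; rewrite in_itv/= xw wy.
  rewrite -/(u w) -/(u v).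
  (* The increment of [u / psi] splits into a bounded multiple of that of [u] and a Lipschitz
     term. *)
  rewrite (_ : _ - _ = (psi w)^-1 * (u w - u v) -
                       u v * ((psi v)^-1 * (psi w)^-1 * (psi w - psi v))); last first.
    by field; rewrite v0 w0.
  rewrite (le_trans (ler_normB _ _))// lerD// !normrM; first by rewrite ler_wpM2r// HP.
  rewrite -!mulrA ler_pM ?mulr_ge0//; first exact: HB.
  rewrite ler_pM ?mulr_ge0//; first exact: HP.
  by rewrite ler_pM ?mulr_ge0//; [exact: HP|exact: HK].
- have mxy : measurable (`]x, y[%classic : set R) by exact: measurable_itv.
  have mc g : {within `[x, y], continuous g} -> measurable_fun (`]x, y[%classic : set R) g.
    move=> cg; apply: subspace_continuous_measurable_fun => //.
    exact: continuous_subspaceW (@subset_itv_oo_cc _ _ x y) cg.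
  rewrite (_ : k = fun t => ((derive1 f t - m * dchi t) * psi t -
      (f t - m * chi t) * dpsi t) * (psi t)^-1 ^+ 2); last first.
    by apply/funext => t; rewrite /k exprVn.
  (* Inside the interval [f] agrees locally with its clamped extension, which is continuous on the
     line and so has a Borel measurable derivative. *)
  have mdf : measurable_fun (`]x, y[%classic : set R) (derive1 f).
    have := measurable_derive1 (continuous_clamp xy acf).
    move=> /(measurable_funS measurableT (@subsetT _ `]x, y[%classic)).
    apply: eq_measurable_fun => t; rewrite inE /= => txy.
    rewrite !derive1E; apply: near_eq_derive.
    near=> z; have : z \in `]x, y[ by near: z; exact: near_in_itvoo.
    by rewrite in_itv/= => /andP[xz zy]; rewrite /= clamp_id// ltW.
  have mm (g : R -> R) (c : R) : measurable_fun (`]x, y[%classic : set R) g ->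
      measurable_fun (`]x, y[%classic : set R) (fun t => c * g t).
    by move=> mg; apply: measurable_funM.
  apply: measurable_funM; last by apply: measurable_funX; exact: mc.
  apply: measurable_funB; apply: measurable_funM.
  + by apply: measurable_funB => //; apply: mm; apply: mc; exact: continuous_subspaceW cdchi.
  + exact: mc.
  + by apply: measurable_funB; [exact: mc|apply: mm; exact: mc].
  + by apply: mc; exact: continuous_subspaceW cdpsi.
have [yx|{}xy] := leP y x.
  apply: aeW => t; rewrite in_itv/= => /andP[xt ty].
  by have := lt_le_trans (lt_trans xt ty) yx; rewrite ltxx.
have [h [_ _]] := abs_cont_derive_density xy acf.
apply: filterS; first exact: (ae_filter_ringOfSetsType mu).
move=> t dft txy; have {}dft := dft txy.
have dchit : is_derive t 1 chi (dchi t).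
  by apply: deriv_within_is_derive dgchi _; exact: itv_nbhs txy.
have dpsit : is_derive t 1 psi (dpsi t).
  by apply: deriv_within_is_derive dgpsi _; exact: itv_nbhs txy.
have t0 : psi t != 0 by apply: psi0; exact: subset_itv_oo_cc txy.
have dfE : derive1 f t = h t by rewrite derive1E; case: dft.
have dV := is_deriveV t0 dpsit.
have du := is_deriveB dft (is_deriveZ m dchit).
apply: is_derive_eq (is_deriveM du dV) _.
rewrite /k dfE -![_ *: _]/(_ * _) !fctE/= -[m *: chi t]/(m * chi t); field.
by rewrite t0.
Unshelve. all: by end_near. Qed.

End C1.

(** * Improper integrals and asymptotic expansions *)

Section filter.
Context {R : realType}.

Lemma to_x0_proper (T : R) (x0 : \bar R) : (T%:E < x0)%E -> ProperFilter (to_x0 x0).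
Proof.
case: x0 => [r _|_|//] /=; first exact: at_left_proper_filter.
exact: proper_pinfty_nbhs.
Qed.

Lemma near_to_x0 (x : R) (x0 : \bar R) : (x%:E < x0)%E ->
  \forall y \near to_x0 x0, x < y /\ (y%:E < x0)%E.
Proof.
case: x0 => [r|_|//] /=.
  rewrite lte_fin => xr; near=> y; rewrite lte_fin; split.
    by near: y; exact: nbhs_left_gt.
  by near: y; exact: nbhs_left_lt.
near=> y; split; last by rewrite ltry.
by near: y; apply: nbhs_pinfty_gt; rewrite num_real.
Unshelve. all: by end_near. Qed.

Lemma littleo_atP (F : set_system R) (FF : Filter F) (h g : R -> R) :
  (\forall x \near F, g x != 0) ->
  littleo_at F h g <-> (fun x => h x / g x) @ F --> (0 : R).
Proof.
move=> g0; split => [hg|/cvgrPdist_le hg e e0].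
  apply/cvgrPdist_le => e e0; have := hg e e0; apply: filterS2 g0 => x gx.
  by rewrite sub0r normrN normrM normfV ler_pdivrMr ?normr_gt0.
have := hg e e0; apply: filterS2 g0 => x gx.
by rewrite sub0r normrN normrM normfV ler_pdivrMr ?normr_gt0.
Qed.

End filter.

Section quotient.
Context {R : realType}.
Notation mu := (@lebesgue_measure R).
(** [S] will be all of [Iset T x0] for [psi = phi1], and the interval without [T] for [psi = Phi],
    which vanishes at [T]. *)
Variables (T : R) (x0 : \bar R) (phi2 dphi2 psi dpsi f : R -> R) (S : set R).
Local Notation F := (to_x0 x0).
Hypotheses (Tx0 : (T%:E < x0)%E)
  (C1phi2 : C1_on (Iset T x0) phi2 dphi2) (C1psi : C1_on (Iset T x0) psi dpsi)
  (acf : AC_on T x0 f).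
Hypotheses (SI : S `<=` Iset T x0)
  (Sup : forall x t, S x -> x <= t -> (t%:E < x0)%E -> S t)
  (FS : F S) (psi0 : forall t, S t -> psi t != 0)
  (phi20 : forall t, Iset T x0 t -> phi2 t != 0)
  (phi2psi : (fun x => phi2 x / psi x) @ F --> (0 : R)).

Definition quotient_derivative (m t : R) :=
  ((derive1 f t - m * dphi2 t) * psi t - (f t - m * phi2 t) * dpsi t) / psi t ^+ 2.

#[local] Instance FF : ProperFilter F := to_x0_proper Tx0.

(** The integral over [[x, y]] is the difference of the end values of [(f - m * phi2) / psi]; let
    [y] tend to [x0]. *)
Lemma improper_int_quotient (m x : R) (g : R -> R) (L : R) : S x ->
  (forall t, S t -> g t = quotient_derivative m t) ->
  improper_int x0 g x L <->
  (fun y => (f y - m * phi2 y) / psi y) @ F --> L + (f x - m * phi2 x) / psi x.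
Proof.
move=> Sx gE.
have [Tx xx0] := SI Sx.
have FTC y : x <= y -> (y%:E < x0)%E ->
    mu.-integrable `[x, y] (EFin \o g) /\
    \int[mu]_(t in `[x, y]) g t =
      (f y - m * phi2 y) / psi y - (f x - m * phi2 x) / psi x.
  move=> xy yx0.
  have inS t : x <= t -> t <= y -> S t.
    by move=> xt ty; apply: (Sup Sx) => //; rewrite (le_lt_trans _ yx0)// lee_fin.
  have xyI : `[x, y] `<=` Iset T x0.
    by move=> t /=; rewrite in_itv/= => /andP[? ?]; apply/SI/inS.
  have xyacf : abs_cont_on x y f.
    by apply: acf => //; apply/SI/inS.
  have psixy t : x <= t -> t <= y -> psi t != 0.
    by move=> xt ty; exact/psi0/inS.
  have [ik ikE] := quotient_FTC m C1phi2 C1psi xyI psixy xy xyacf.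
  have kg t : t \in `[x, y] -> quotient_derivative m t = g t.
    by rewrite in_itv/= => /andP[xt ty]; rewrite gE//; exact: inS.
  split.
    apply: eq_integrable ik; first exact: measurable_itv.
    by move=> t; rewrite inE => /= /kg <-.
  rewrite -ikE; apply: eq_Rintegral => t; rewrite inE => /= txy.
  by rewrite -kg.
have near_x : \forall y \near F, x <= y /\ (y%:E < x0)%E.
  by apply: filterS (near_to_x0 xx0) => y [/ltW].
split=> [[_ cv]|cv].
  apply: cvg_trans (cvgD cv (cvg_cst ((f x - m * phi2 x) / psi x))).
  apply: near_eq_cvg; apply: filterS near_x => y [xy yx0].
  by rewrite /= !fctE (FTC _ xy yx0).2 subrK.
split=> [y xy yx0|]; first exact: (FTC y xy yx0).1.
rewrite -[L](addrK ((f x - m * phi2 x) / psi x)).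
apply: cvg_trans (cvgB cv (cvg_cst ((f x - m * phi2 x) / psi x))).
apply: near_eq_cvg; apply: filterS near_x => y [xy yx0].
by rewrite /= !fctE (FTC _ xy yx0).2.
Qed.

(** The quotient is [c] plus [(f - c * psi) / phi2 - m] times [phi2 / psi], which tends to 0. *)
Lemma expansion_cvg (c r : R) : (fun x => (f x - c * psi x) / phi2 x) @ F --> r ->
  forall m, (fun x => (f x - m * phi2 x) / psi x) @ F --> c.
Proof.
move=> cv m.
have -> : c = c + r * 0 - m * 0 by ring.
apply: cvg_trans (cvgB (cvgD (cvg_cst c) (cvgM cv phi2psi))
                       (cvgM (cvg_cst m) phi2psi)).
apply: near_eq_cvg; apply: filterS FS => x Sx; rewrite !fctE /=.
by field; rewrite psi0// phi20//; exact: SI.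
Qed.

(** With [c] the limit of [f / psi], the improper integral is [J = c - f / psi], so [psi / phi2 * J]
    is the negative of [(f - c * psi) / phi2]. *)
Lemma improper_int_expansion (g : R -> R) (r : R) :
  (forall t, S t -> g t = quotient_derivative 0 t) ->
  (exists J : R -> R, (forall x, S x -> improper_int x0 g x (J x)) /\
     (fun x => psi x / phi2 x * J x) @ F --> - r) <->
  exists c, (fun x => (f x - c * psi x) / phi2 x) @ F --> r.
Proof.
move=> gE; split=> [[J [HJ cv]]|[c cv]].
  have [x Sx] : exists x, S x by exact: filter_ex FS.
  have cvf := (improper_int_quotient _ Sx gE).1 (HJ x Sx).
  exists (J x + (f x - 0 * phi2 x) / psi x).
  have /cvgN := cv; rewrite opprK; apply: cvg_trans.
  apply: near_eq_cvg; apply: filterS FS => y Sy; rewrite !fctE /=.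
  have cvf' := (improper_int_quotient _ Sy gE).1 (HJ y Sy).
  (* The constant read off at [x] equals the one at [y], both being the limit of [f / psi]. *)
  rewrite (cvg_unique _ cvf cvf')//; set j := J y.
  by field; rewrite psi0// phi20//; exact: SI.
exists (fun x => c - (f x - 0 * phi2 x) / psi x); split=> [x Sx|].
  by apply/(improper_int_quotient _ Sx gE); rewrite subrK; exact: expansion_cvg cv _.
apply: cvg_trans (cvgN cv); apply: near_eq_cvg; apply: filterS FS => y Sy.
by rewrite !fctE /=; field; rewrite psi0// phi20//; exact: SI.
Qed.

(** For [m = r] the improper integral is [c - (f - r * phi2) / psi]; solving for [f] gives the
    formula. *)
Lemma expansion_formula (g : R -> R) (c r : R) :
  (fun x => (f x - c * psi x) / phi2 x) @ F --> r ->
  (forall t, S t -> g t = quotient_derivative r t) ->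
  exists J : R -> R, forall x, S x -> improper_int x0 g x (J x) /\
    f x = c * psi x + r * phi2 x - psi x * J x.
Proof.
move=> cv gE; exists (fun x => c - (f x - r * phi2 x) / psi x) => x Sx; split.
  by apply/(improper_int_quotient _ Sx gE); rewrite subrK; exact: expansion_cvg cv _.
by field; exact: psi0.
Qed.

End quotient.

(** * Linear combinations of [phi1] and [phi2] *)

Section C1_combination.
Context {R : realType}.
Variables (T : R) (x0 : \bar R) (phi1 phi2 dphi1 dphi2 : R -> R).
Hypotheses (C1phi1 : C1_on (Iset T x0) phi1 dphi1)
  (C1phi2 : C1_on (Iset T x0) phi2 dphi2).

Lemma C1_onB (a b : R) : C1_on (Iset T x0) (fun x => a * phi1 x - b * phi2 x)
  (fun x => a * dphi1 x - b * dphi2 x).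
Proof.
have [[d1 c1] [d2 c2]] := (C1phi1, C1phi2); split.
  move=> x Ix; apply: cvg_trans (cvgB (cvgM (cvg_cst a) (d1 x Ix)) (cvgM (cvg_cst b) (d2 x Ix))).
  by apply: near_eq_cvg; apply: nearW => y; rewrite !fctE /=; ring.
move: c1 c2 => /subspace_continuousP c1 /subspace_continuousP c2.
apply/subspace_continuousP => x Ix.
exact: cvgB (cvgM (cvg_cst a) (c1 x Ix)) (cvgM (cvg_cst b) (c2 x Ix)).
Qed.

(* [phi2 / phi1] has derivative [W / phi1 ^ 2], which never vanishes: by Rolle's
   theorem it takes its value at [T] only once. *)
Lemma quotient_injective_at_left_end :
  (forall x, Iset T x0 x -> phi1 x != 0) ->
  (forall x, Iset T x0 x -> wronsk phi1 dphi1 phi2 dphi2 x != 0) ->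
  forall x, T < x -> (x%:E < x0)%E -> phi2 T * phi1 x - phi1 T * phi2 x != 0.
Proof.
move=> phi10 W0 x Tx xx0; apply/eqP => Phi0.
have TxI : `[T, x] `<=` Iset T x0.
  move=> t; rewrite /= in_itv/= => /andP[Tt tx]; split => //.
  by rewrite (le_lt_trans _ xx0)// lee_fin.
have inI t : T <= t -> t <= x -> Iset T x0 t.
  by move=> Tt tx; apply: TxI; rewrite /= in_itv/= Tt tx.
have dq t : t \in `]T, x[ -> is_derive t 1 (phi2 * (fun t => (phi1 t)^-1))
    (wronsk phi1 dphi1 phi2 dphi2 t / phi1 t ^+ 2).
  move=> Ttx; have phi1t : phi1 t != 0.
    by move: Ttx; rewrite in_itv/= => /andP[Tt tx]; apply/phi10/inI; exact: ltW.
  have nt := itv_nbhs TxI Ttx.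
  have dphi1t := deriv_within_is_derive C1phi1.1 nt.
  have dphi2t := deriv_within_is_derive C1phi2.1 nt.
  apply: is_derive_eq (is_deriveM dphi2t (is_deriveV phi1t dphi1t)) _.
  by rewrite -![_ *: _]/(_ * _) /wronsk; field.
have [|||c cTx dc] := Rolle (f := phi2 * (fun t => (phi1 t)^-1)) Tx.
- by move=> t /dq[].
- have c1 := within_continuousV (fun t Tt => phi10 t (TxI t Tt))
    (continuous_subspaceW TxI (deriv_within_continuous C1phi1.1)).
  have c2 := continuous_subspaceW TxI (deriv_within_continuous C1phi2.1).
  by move=> t; apply: cvgM; [exact: c2|exact: c1].
- have phi1T : phi1 T != 0 by apply/phi10/inI => //; exact: ltW.
  have phi1x : phi1 x != 0 by apply/phi10/inI => //; exact: ltW.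
  rewrite !fctE; apply/eqP; rewrite eqr_div//; apply/eqP.
  by move/eqP: Phi0; rewrite subr_eq0 => /eqP ->; rewrite mulrC.
have Ic : Iset T x0 c by apply: TxI; exact: subset_itv_oo_cc cTx.
have [_ dc1] := dq c cTx; have [_ dc0] := dc.
have /eqP := etrans (esym dc1) dc0.
by rewrite mulf_eq0 invr_eq0 expf_eq0/= (negbTE (W0 c Ic)) (negbTE (phi10 c Ic)).
Qed.

End C1_combination.

(** * Expansions in [phi1] and [phi2] as limits *)

Section expansion.
Context {R : realType}.

Lemma littleo_expansion (F : set_system R) (FF : Filter F) (phi1 phi2 f : R -> R)
    (a1 a2 : R) :
  (\forall x \near F, phi2 x != 0) ->
  littleo_at F (fun x => f x - (a1 * phi1 x + a2 * phi2 x)) phi2 <->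
  (fun x => (f x - a1 * phi1 x) / phi2 x) @ F --> a2.
Proof.
move=> phi20; apply: (iff_trans (littleo_atP FF _ phi20)).
split=> cv.
  rewrite -[a2]add0r; apply: cvg_trans (cvgD cv (cvg_cst a2)).
  apply: near_eq_cvg; apply: filterS phi20 => x x0.
  by rewrite !fctE /=; field.
rewrite -(subrr a2); apply: cvg_trans (cvgB cv (cvg_cst a2)).
apply: near_eq_cvg; apply: filterS phi20 => x x0.
by rewrite !fctE /=; field.
Qed.

(** Replacing [phi1] by a combination with [phi2] only shifts the coefficient of [phi2] by a
    constant. *)
Lemma expansion_combination (F : set_system R) (FF : Filter F) (phi1 phi2 f : R -> R)
    (p q c r : R) :
  (\forall x \near F, phi2 x != 0) ->
  (fun x => (f x - c * (p * phi1 x - q * phi2 x)) / phi2 x) @ F --> r <->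
  (fun x => (f x - (c * p) * phi1 x) / phi2 x) @ F --> r - c * q.
Proof.
move=> phi20; split=> cv.
  apply: cvg_trans (cvgB cv (cvg_cst (c * q))).
  apply: near_eq_cvg; apply: filterS phi20 => x x0.
  by rewrite !fctE /=; field.
rewrite -(subrK (c * q) r); apply: cvg_trans (cvgD cv (cvg_cst (c * q))).
apply: near_eq_cvg; apply: filterS phi20 => x x0.
by rewrite !fctE /=; field.
Qed.

End expansion.
Unset Implicit Arguments.

(** * Equivalence of the expansion with both integral conditions, and the representation formulas *)

Theorem theorem4p4 (R : realType) (x0 : \bar R) (T : R)
  (phi1 phi2 dphi1 dphi2 f : R -> R) :
  (T%:E < x0)%E ->
  C1_on (Iset T x0) phi1 dphi1 ->
  C1_on (Iset T x0) phi2 dphi2 ->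
  littleo_at (to_x0 x0) phi2 phi1 ->
  (forall x, Iset T x0 x -> phi1 x != 0) ->
  (forall x, Iset T x0 x -> phi2 x != 0) ->
  (forall x, Iset T x0 x -> wronsk phi1 dphi1 phi2 dphi2 x != 0) ->
  AC_on T x0 f ->
  let W := wronsk phi1 dphi1 phi2 dphi2 in
  let f1s := fun t => wronsk f (derive1 f) phi2 dphi2 t / W t in
  let f2s := fun t => - wronsk f (derive1 f) phi1 dphi1 t / W t in
  let Phi := fun x => phi2 T * phi1 x - phi1 T * phi2 x in
  let Fs := fun t => phi1 T * f1s t + phi2 T * f2s t in
  let cond_i := fun a1 a2 : R =>
    littleo_at (to_x0 x0) (fun x => f x - (a1 * phi1 x + a2 * phi2 x)) phi2 in
  let cond_ii := fun m : R => exists J : R -> R,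
    (forall x, Iset T x0 x ->
       improper_int x0 (fun t => W t / phi1 t ^+ 2 * f2s t) x (J x)) /\
    (fun x => phi1 x / phi2 x * J x) @ to_x0 x0 --> - m in
  let cond_iii := fun l : R => exists J : R -> R,
    (forall x, T < x -> (x%:E < x0)%E ->
       improper_int x0 (fun t => W t / Phi t ^+ 2 * Fs t) x (J x)) /\
    (fun x => Phi x / phi2 x * J x) @ to_x0 x0 --> - (l / phi2 T) in
  ((exists a1 a2, cond_i a1 a2) <-> (exists m, cond_ii m)) /\
  ((exists m, cond_ii m) <-> (exists l, cond_iii l)) /\
  (forall a1 a2 m l, cond_i a1 a2 -> cond_ii m -> cond_iii l ->
     (exists J : R -> R, forall x, Iset T x0 x ->
        improper_int x0 (fun t => W t / phi1 t ^+ 2 * (f2s t - m)) x (J x) /\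
        f x = a1 * phi1 x + a2 * phi2 x - phi1 x * J x) /\
     (exists J : R -> R, forall x, T < x -> (x%:E < x0)%E ->
        improper_int x0 (fun t => W t / Phi t ^+ 2 * (Fs t - l)) x (J x) /\
        f x = a1 * phi1 x + a2 * phi2 x - Phi x * J x)).
Proof.
move=> Tx0 C1phi1 C1phi2 littleo phi10 phi20 W0 acf W f1s f2s Phi Fs cond_i cond_ii cond_iii.
pose F := to_x0 x0.
have FF : ProperFilter F := to_x0_proper Tx0.
have IT : Iset T x0 T by split.
have nearI : F (Iset T x0).
  by apply: filterS (near_to_x0 Tx0) => x [/ltW].
pose S : set R := [set x | T < x /\ (x%:E < x0)%E].
have nearS : F S by exact: near_to_x0.
have SI : S `<=` Iset T x0 by move=> x [/ltW].
have Iup x t : Iset T x0 x -> x <= t -> (t%:E < x0)%E -> Iset T x0 t.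
  by move=> [Tx _] xt tx0; split => //; exact: le_trans xt.
have Sup x t : S x -> x <= t -> (t%:E < x0)%E -> S t.
  by move=> [Tx _] xt tx0; split => //; exact: lt_le_trans xt.
have near_phi2 : \forall x \near F, phi2 x != 0 by apply: filterS nearI.
have near_phi1 : \forall x \near F, phi1 x != 0 by apply: filterS nearI.
have phi21 : (fun x => phi2 x / phi1 x) @ F --> (0 : R) by exact/littleo_atP.
have C1Phi := C1_onB C1phi1 C1phi2 (phi2 T) (phi1 T).
have Phi0 t : S t -> Phi t != 0.
  by move=> [Tt tx0]; exact: (quotient_injective_at_left_end C1phi1 C1phi2).
have phi2T := phi20 T IT.
have phi2Phi : (fun x => phi2 x / Phi x) @ F --> (0 : R).
  (* Dividing by [phi1] writes [phi2 / Phi] as a function of [phi2 / phi1], with nonzero limit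
     [phi2 T] in the denominator. *)
  have -> : 0 = 0 / (phi2 T - phi1 T * 0) :> R by rewrite mul0r.
  have n0 : phi2 T - phi1 T * 0 != 0 by rewrite mulr0 subr0.
  apply: cvg_trans (cvgM phi21 (cvgV n0 (cvgB (cvg_cst (phi2 T)) (cvgM (cvg_cst (phi1 T)) phi21)))).
  apply: near_eq_cvg; apply: filterS nearS => x Sx; rewrite !fctE /=.
  have Ix := SI x Sx; have := Phi0 x Sx; rewrite /Phi => Px.
  by field; rewrite Px phi10.
have iE a1 a2 : cond_i a1 a2 <-> (fun x => (f x - a1 * phi1 x) / phi2 x) @ F --> a2.
  exact: (littleo_expansion _ phi1 f a1 a2 near_phi2).
have combE c r : (fun x => (f x - c * Phi x) / phi2 x) @ F --> r <->
    cond_i (c * phi2 T) (r - c * phi1 T).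
  apply: iff_trans (iff_sym (iE _ _)).
  exact: (expansion_combination _ phi1 f (phi2 T) (phi1 T) c r near_phi2).
have g2E m t : Iset T x0 t ->
    W t / phi1 t ^+ 2 * (f2s t - m) = quotient_derivative phi2 dphi2 phi1 dphi1 f m t.
  move=> It; have := W0 t It; have := phi10 t It.
  rewrite /f2s /W /quotient_derivative /wronsk => p0 w0.
  by field; rewrite w0 p0.
have g2E0 t : Iset T x0 t ->
    W t / phi1 t ^+ 2 * f2s t = quotient_derivative phi2 dphi2 phi1 dphi1 f 0 t.
  by move=> It; rewrite -g2E// subr0.
(* The derivative of [phi2 / Phi] is [phi2 T * W / Phi ^+ 2], so subtracting [l] from [Fs] removes
   [l / phi2 T] times [phi2] from [f]. *)
have g3E l t : S t -> W t / Phi t ^+ 2 * (Fs t - l) =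
    quotient_derivative phi2 dphi2 Phi
      (fun x => phi2 T * dphi1 x - phi1 T * dphi2 x) f (l / phi2 T) t.
  move=> St; have := W0 t (SI t St); have := Phi0 t St.
  rewrite /Fs /f2s /f1s /W /quotient_derivative /wronsk /Phi => p0 w0.
  by field; rewrite w0 p0 phi2T.
have g3E0 t : S t -> W t / Phi t ^+ 2 * Fs t =
    quotient_derivative phi2 dphi2 Phi
      (fun x => phi2 T * dphi1 x - phi1 T * dphi2 x) f 0 t.
  by move=> St; rewrite -(mul0r (phi2 T)^-1) -g3E// subr0.
have idI : Iset T x0 `<=` Iset T x0 by [].
have iiE m : cond_ii m <-> exists c, cond_i c m.
  apply: (iff_trans (improper_int_expansion Tx0 C1phi2 C1phi1 acf idI Iup nearI
    phi10 phi20 phi21 m g2E0)).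
  by split=> -[c cv]; exists c; apply/iE.
have iiiE l : cond_iii l <-> exists c, cond_i (c * phi2 T) (l / phi2 T - c * phi1 T).
  have H := improper_int_expansion Tx0 C1phi2 C1Phi acf SI Sup nearS
    Phi0 phi20 phi2Phi (l / phi2 T) g3E0.
  apply: (@iff_trans _ (exists c, (fun x => (f x - c * Phi x) / phi2 x) @ F --> l / phi2 T)).
    apply: iff_trans H; split=> -[J [HJ cv]]; exists J; split => //.
      by move=> x [? ?]; exact: HJ.
    by move=> x ? ?; exact: HJ.
  by split=> -[c cv]; exists c; exact/combE.
(* The first coefficient is the limit of [f / phi1], and it determines the second. This ties the
   constants hidden in the integral conditions to the given [a1] and [a2]. *)
have uniq a1 a2 b1 b2 : cond_i a1 a2 -> cond_i b1 b2 -> a1 = b1 /\ a2 = b2.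
  move=> /iE ca /iE cb.
  have ec c r (cv : (fun x => (f x - c * phi1 x) / phi2 x) @ F --> r) :=
    expansion_cvg Tx0 idI nearI phi10 phi20 phi21 cv 0.
  have ab : a1 = b1 by apply: (cvg_unique _ (ec _ _ ca) (ec _ _ cb)).
  by split => //; rewrite ab in ca; exact: (cvg_unique _ ca cb).
split.
  split=> [[a1 [a2 ci]]|[m /iiE[c ci]]]; last by exists c, m.
  by exists a2; apply/iiE; exists a1.
split.
  split=> [[m /iiE[c ci]]|[l /iiiE[c ci]]].
    (* These solve [c' * phi2 T = c] and [l / phi2 T - c' * phi1 T = m] for [c'] and [l]. *)
    exists (phi2 T * m + c * phi1 T); apply/iiiE; exists (c / phi2 T).
    rewrite divfK// (_ : _ - _ = m)//; by field.
  by exists (l / phi2 T - c * phi1 T); apply/iiE; exists (c * phi2 T).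
move=> a1 a2 m l ci /iiE[c cm] /iiiE[d cl].
have [ca ma] := uniq _ _ _ _ cm ci; have [da la] := uniq _ _ _ _ cl ci.
split.
  (* By uniqueness [m] is the coefficient [a2]. *)
  move: ci => /iE cv; rewrite -ma in cv *.
  exact: (expansion_formula Tx0 C1phi2 C1phi1 acf idI Iup nearI phi10 phi20 phi21 cv (g2E m)).
move: cl => /combE cv.
have [J HJ] := expansion_formula Tx0 C1phi2 C1Phi acf SI Sup nearS Phi0 phi20 phi2Phi
  cv (g3E l).
exists J => x Tx xx0; have [Jx ->] := HJ x (conj Tx xx0); split => //.
(* Expanding [d * Phi + l / phi2 T * phi2] gives back the coefficients [a1 = d * phi2 T] and
   [a2 = l / phi2 T - d * phi1 T]. *)
by rewrite -da -la /Phi; ring.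
Qed.
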